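(* Let $T>0$, $x_0,x_T\in\mathbb R^n$, $\underline u_j,\overline u_j\in\mathbb R$ ($j=1,\dots,m$), and let $f=(f_1,\dots,f_n):\mathbb R^n\times\mathbb R^m\times[0,T]\to\mathbb R^n$ be continuous, with each $f_i(x,u,t)$ quasidifferentiable and locally Lipschitz continuous in $(x,u)$ for each $t\in[0,T]$. Let $\xi=(x,z,u)\in C_n[0,T]\times P_n[0,T]\times P_m[0,T]$ be such that the compact-convex-valued mappings $t\mapsto\underline\partial\varphi(\xi,t)$ and $t\mapsto\overline\partial\varphi(\xi,t)$ defined in the context are upper semicontinuous on $[0,T]$. Then $$\max_{w\in\overline\partial I(x,z,u)}\ \min_{v\in\underline\partial I(x,z,u)}\int_0^T\big(v(t)+w(t)\big)^2dt=\int_0^T\ \max_{w\in\overline\partial\varphi(\xi,t)}\ \min_{v\in\underline\partial\varphi(\xi,t)}(v+w)^2\,dt .$$ Consequently, in order to solve the max-min problem on the left-hand side it is sufficient to solve, for each $t\in[0,T]$, the finite-dimensional problem $\max_{w\in\overline\partial\varphi(\xi,t)}\min_{v\in\underline\partial\varphi(\xi,t)}(v+w)^2$ (i.e. to find the Hausdorff deviation of the set $-\overline\partial\varphi(\xi,t)$ from the set $\underline\partial\varphi(\xi,t)$): if measurable $\overline v,\overline w$ with $\overline v(t)\in\underline\partial\varphi(\xi,t)$, $\overline w(t)\in\overline\partial\varphi(\xi,t)$ solve the latter problem for each $t\in[0,T]$, then $\overline v,\overline w$ solve the former.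
   Context: $C_n[0,T]$ is the space of continuous functions $[0,T]\to\mathbb R^n$; $P_k[0,T]$ is the space of piecewise continuous functions $[0,T]\to\mathbb R^k$ (value at a discontinuity $t_0\in[0,T)$ is the right limit; value at $T$ is the left limit). The square of a vector denotes its squared Euclidean norm. Quasidifferentiability of $f_i$ at $(x,u)$, for given $t$: there are convex compact sets $\underline\partial f_i(x,u,t),\overline\partial f_i(x,u,t)\subset\mathbb R^n\times\mathbb R^m$ with $$\lim_{\alpha\downarrow0}\tfrac1\alpha\big(f_i(x+\alpha g_1,u+\alpha g_2,t)-f_i(x,u,t)\big)=\max_{v\in\underline\partial f_i(x,u,t)}\langle v,g\rangle+\min_{w\in\overline\partial f_i(x,u,t)}\langle w,g\rangle$$ for all $g=(g_1,g_2)\in\mathbb R^n\times\mathbb R^m$. Fix such a choice of sets for every $(x,u,t)$. The functional under consideration is $$I(x,z,u)=\sum_{i=1}^n\int_0^T|z_i(t)-f_i(x(t),u(t),t)|dt+\tfrac12\Big(x_0+\int_0^Tz(t)dt-x_T\Big)^2+\sum_{j=1}^m\int_0^T\max\{\underline u_j-u_j(t),0\}dt+\sum_{j=1}^m\int_0^T\max\{u_j(t)-\overline u_j,0\}dt+\tfrac12\int_0^T\Big(x(t)-x_0-\int_0^tz(\tau)d\tau\Big)^2dt.$$ Set-valued maps. For $\xi=(x,z,u)$ and $t\in[0,T]$ put $\underline\partial\varphi(\xi,t)=\sum_{k=1}^4\underline\partial\varphi_k(x,z,u,t)$ and $\overline\partial\varphi(\xi,t)=\sum_{k=1}^4\overline\partial\varphi_k(x,z,u,t)$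 (Minkowski sums of subsets of $\mathbb R^n\times\mathbb R^n\times\mathbb R^m$, vectors written as (x-part, z-part, u-part)), where the summands are as follows. Sets $\underline\partial f_i,\overline\partial f_i$ (evaluated at $(x(t),u(t),t)$) are regarded as subsets of $\mathbb R^n\times\mathbb R^n\times\mathbb R^m$ via $(a,b)\mapsto(a,0_n,b)$; $e_i$ denotes the vector with $1$ in the $(n+i)$-th coordinate and zeros elsewhere; $\epsilon_j$ denotes the vector with $1$ in the $(2n+j)$-th coordinate and zeros elsewhere; $\mathrm{co}$ is the convex hull of the union. - $\underline\partial\varphi_1=\sum_{i=1}^nA_i$, $\overline\partial\varphi_1=\sum_{i=1}^nB_i$, where, with $h_i=z_i(t)-f_i(x(t),u(t),t)$: if $h_i>0$, $A_i=e_i-\overline\partial f_i$, $B_i=-\underline\partial f_i$; if $h_i<0$, $A_i=-e_i+\underline\partial f_i$, $B_i=\overline\partial f_i$; if $h_i=0$, $A_i=\mathrm{co}\{e_i-2\overline\partial f_i,\ -e_i+2\underline\partial f_i\}$, $B_i=-\underline\partial f_i+\overline\partial f_i$. - $\underline\partial\varphi_2=\{(0_n,\ x_0+\int_0^Tz(\tau)d\tau-x_T,\ 0_m)\}$, $\overline\partial\varphi_2=\{0\}$. - $\underline\partial\varphi_3=\sum_{j=1}^m(C_j+D_j)$, $\overline\partial\varphi_3=\{0\}$, where $C_j=\{\epsilon_j\}$, $\{0\}$, or $\mathrm{co}\{\epsilon_j,0\}$ according as $u_j(t)-\overline u_j$ is $>0$, $<0$, or $=0$, and $D_j=\{-\epsilon_j\}$,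 $\{0\}$, or $\mathrm{co}\{-\epsilon_j,0\}$ according as $\underline u_j-u_j(t)$ is $>0$, $<0$, or $=0$. - $\underline\partial\varphi_4=\{(x(t)-x_0-\int_0^tz(\tau)d\tau,\ -\int_t^T(x(\tau)-x_0-\int_0^\tau z(s)ds)d\tau,\ 0_m)\}$, $\overline\partial\varphi_4=\{0\}$. The subdifferential $\underline\partial I(x,z,u)$ (resp. superdifferential $\overline\partial I(x,z,u)$) is identified with the set of all $v\in L^\infty([0,T];\mathbb R^{2n+m})$ with $v(t)\in\underline\partial\varphi(\xi,t)$ for all $t\in[0,T]$ (resp. all $w\in L^\infty([0,T];\mathbb R^{2n+m})$ with $w(t)\in\overline\partial\varphi(\xi,t)$ for all $t$). A set-valued mapping $t\mapsto F(t)$ with compact values is upper semicontinuous if for each $t$ and each $r>0$ there is $\delta>0$ such that $F(\overline t)$ lies in the $r$-neighbourhood of $F(t)$ whenever $|\overline t-t|<\delta$, $\overline t\in[0,T]$. The Hausdorff deviation of a compact set $B$ from a compact set $A$ is $\max_{b\in B}\min_{a\in A}\|b-a\|$. *)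

(* Defs.v *)
From mathcomp Require Import all_boot all_order all_algebra.
From mathcomp Require Import all_classical all_reals all_analysis.

Set Implicit Arguments.
Unset Strict Implicit.
Unset Printing Implicit Defensive.

Import Order.TTheory GRing.Theory Num.Theory.
Import numFieldNormedType.Exports.

Local Open Scope classical_set_scope.
Local Open Scope ring_scope.

(* The library norm of 'rV[R]_k is the sup norm; these are the Euclidean
   notions. *)
Definition dotp {R : realType} {k : nat} (v w : 'rV[R]_k) : R :=
  \sum_i v 0 i * w 0 i.
Definition sqnorm {R : realType} {k : nat} (v : 'rV[R]_k) : R := dotp v v.
Definition enorm {R : realType} {k : nat} (v : 'rV[R]_k) : R :=
  Num.sqrt (sqnorm v).

Section MaxMin.
Context {d : Order.disp_t} {K : porderType d} {X : Type}.

(* "c = max_(a in A) F a" and "c = min_(a in A) F a", the extremum being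
   attained; in particular A is nonempty. *)
Definition is_max (A : set X) (F : X -> K) (c : K) : Prop :=
  (exists2 a, A a & F a = c) /\ (forall a, A a -> (F a <= c)%O).
Definition is_min (A : set X) (F : X -> K) (c : K) : Prop :=
  (exists2 a, A a & F a = c) /\ (forall a, A a -> (c <= F a)%O).

End MaxMin.

Section MaxMinProblem.
Context {d : Order.disp_t} {K : porderType d} {X Y : Type}.
Variables (W : set X) (V : set Y) (F : X -> Y -> K).

(* "c = max_(w in W) min_(v in V) F w v" *)
Definition is_maxmin (c : K) : Prop :=
  exists2 g : X -> K,
    (forall w, W w -> is_min V (F w) (g w)) & is_max W g c.

(* (w, v) solves this problem: w attains the outer maximum, and v attains the
   inner minimum for this w. *)
Definition solves_maxmin (w : X) (v : Y) : Prop :=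
  [/\ W w, V v, is_min V (F w) (F w v) & is_maxmin (F w v)].

End MaxMinProblem.

(* Hausdorff deviation of B from A *)
Definition is_hausdorff_dev {R : realType} {k : nat} (B A : set 'rV[R]_k)
    (c : R) : Prop :=
  is_maxmin B A (fun b a => enorm (b - a)) c.

Section SetOperations.
Context {R : realType} {V : lmodType R}.

Definition addset (A B : set V) : set V := [set a + b | a in A & b in B].
Definition sumset (I : finType) (A : I -> set V) : set V :=
  [set v | exists2 a : I -> V, (forall i, A i (a i)) & v = \sum_i a i].
(* convex hull of the union of A and B *)
Definition co (A B : set V) : set V :=
  smallest (@convex_set R V) (A `|` B).

End SetOperations.

(* (L, U) is a quasidifferential of g at (x, u); a subset of R^n x R^m is a set
   of concatenated row vectors. *)
Definition is_quasidifferential {R : realType} {n m : nat}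
    (g : 'rV[R]_n -> 'rV[R]_m -> R) (x : 'rV[R]_n) (u : 'rV[R]_m)
    (L U : set 'rV[R]_(n + m)) : Prop :=
  [/\ convex_set L, compact L, convex_set U, compact U &
      forall (g1 : 'rV[R]_n) (g2 : 'rV[R]_m), exists M N : R,
        [/\ is_max L (fun v => dotp v (row_mx g1 g2)) M,
            is_min U (fun w => dotp w (row_mx g1 g2)) N &
            (fun a : R => a^-1 * (g (x + a *: g1) (u + a *: g2) - g x u))
              @ 0^'+ --> M + N]].

Definition locally_lipschitz {R : realType} {V W : normedModType R}
    (g : V -> W) : Prop :=
  forall p : V, lipschitz_on g (nbhs (p, p)).

(* Membership in P_k[0,T]. On ]0, T[ the right-continuity clause makes the
   value at a discontinuity the right limit. *)
Definition piecewise_continuous {R : realType} {k : nat} (T : R)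
    (z : R -> 'rV[R]_k) : Prop :=
  [/\ forall t : R, t \in `[0, T[ -> z s @[s --> t^'+] --> z t,
      z s @[s --> T^'-] --> z T,
      forall t : R, t \in `]0, T] -> exists l : 'rV[R]_k, z s @[s --> t^'-] --> l &
      finite_set [set t : R | (t \in `]0, T[) /\ ~ {for t, continuous z}]].

Definition upper_semicontinuous {R : realType} {k : nat} (T : R)
    (F : R -> set 'rV[R]_k) : Prop :=
  forall t : R, t \in `[0, T] -> forall r : R, 0 < r ->
    exists2 delta : R, 0 < delta &
      forall s : R, s \in `[0, T] -> `|s - t| < delta ->
        forall y, F s y -> exists2 a, F t a & enorm (y - a) < r.

(* Lebesgue measure on the sigma-algebra of Lebesgue (not only Borel)
   measurable sets of R. *)
Notation leb R := (@completed_lebesgue_measure R).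
Notation lebesgueR R := (caratheodory_type ((@wlength R idfun)^*)%mu).

Section VectorFunctions.
Context {R : realType} {k : nat}.
Implicit Types (T a b : R) (v : R -> 'rV[R]_k).

Definition vmeasurable T v : Prop :=
  forall i, measurable_fun (`[0, T] : set (lebesgueR R)) (fun t => v t 0 i).

(* v represents an element of L^oo([0,T]; R^k): each coordinate, extended by 0
   outside [0, T], is in L^oo. *)
Definition in_Linfty T v : Prop :=
  forall i, ((fun t => v t 0 i) \_ `[0, T] : lebesgueR R -> R)
              \in Lfun (leb R) +oo%E.

Definition vint a b v : 'rV[R]_k :=
  \row_i (\int[leb R]_(t in `[a, b]) v t 0 i).

End VectorFunctions.

Section Quasidifferential.
Context {R : realType} {n m : nat}.
Variables (T : R) (x0 xT : 'rV[R]_n) (ulo uup : 'rV[R]_m).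
Variable f : 'rV[R]_n -> 'rV[R]_m -> R -> 'rV[R]_n.
(* subf i x u t and supf i x u t: the quasidifferential chosen for f_i *)
Variables subf supf :
  'I_n -> 'rV[R]_n -> 'rV[R]_m -> R -> set 'rV[R]_(n + m).
Variables (x z : R -> 'rV[R]_n) (u : R -> 'rV[R]_m).

Local Notation E := 'rV[R]_(n + n + m).

(* (a, b) |-> (a, 0, b) *)
Definition emb (v : 'rV[R]_(n + m)) : E :=
  row_mx (row_mx (lsubmx v) 0) (rsubmx v).

Definition e_ (i : 'I_n) : E := delta_mx 0 (lshift m (rshift n i)).
Definition eps_ (j : 'I_m) : E := delta_mx 0 (rshift (n + n) j).

Definition h_ (t : R) (i : 'I_n) : R := z t 0 i - f (x t) (u t) t 0 i.
Definition subF (t : R) (i : 'I_n) : set E := emb @` subf i (x t) (u t) t.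
Definition supF (t : R) (i : 'I_n) : set E := emb @` supf i (x t) (u t) t.

Definition subphi1 (t : R) : set E :=
  sumset (fun i : 'I_n =>
    if 0 < h_ t i then [set e_ i - w | w in supF t i]
    else if h_ t i < 0 then [set - e_ i + v | v in subF t i]
    else co [set e_ i - 2 *: w | w in supF t i]
            [set - e_ i + 2 *: v | v in subF t i]).

Definition supphi1 (t : R) : set E :=
  sumset (fun i : 'I_n =>
    if 0 < h_ t i then [set - v | v in subF t i]
    else if h_ t i < 0 then supF t i
    else [set - v + w | v in subF t i & w in supF t i]).

Definition subphi2 (t : R) : set E :=
  [set row_mx (row_mx 0 (x0 + vint 0 T z - xT)) 0].
Definition supphi2 (t : R) : set E := [set 0].

Definition subphi3 (t : R) : set E :=
  sumset (fun j : 'I_m => addset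
    (if 0 < u t 0 j - uup 0 j then [set eps_ j]
     else if u t 0 j - uup 0 j < 0 then [set 0]
     else co [set eps_ j] [set 0])
    (if 0 < ulo 0 j - u t 0 j then [set - eps_ j]
     else if ulo 0 j - u t 0 j < 0 then [set 0]
     else co [set - eps_ j] [set 0])).
Definition supphi3 (t : R) : set E := [set 0].

Definition defect (t : R) : 'rV[R]_n := x t - x0 - vint 0 t z.
Definition subphi4 (t : R) : set E :=
  [set row_mx (row_mx (defect t) (- vint t T defect)) 0].
Definition supphi4 (t : R) : set E := [set 0].

Definition subphi (t : R) : set E :=
  addset (addset (addset (subphi1 t) (subphi2 t)) (subphi3 t)) (subphi4 t).
Definition supphi (t : R) : set E :=
  addset (addset (addset (supphi1 t) (supphi2 t)) (supphi3 t)) (supphi4 t).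

(* sub- and superdifferential of the functional I at (x, z, u) *)
Definition subI : set (R -> E) :=
  [set v | in_Linfty T v /\ forall t : R, t \in `[0, T] -> subphi t (v t)].
Definition supI : set (R -> E) :=
  [set w | in_Linfty T w /\ forall t : R, t \in `[0, T] -> supphi t (w t)].

End Quasidifferential.

(* Main.v *)
Require Import Defs.
From mathcomp Require Import all_boot all_order all_algebra.
From mathcomp Require Import all_classical all_reals all_analysis.
From mathcomp Require Import measurable_realfun ess_sup_inf ring lra.

Set Implicit Arguments.
Unset Strict Implicit.
Unset Printing Implicit Defensive.

Import Order.TTheory GRing.Theory Num.Theory.
Import numFieldNormedType.Exports.

Local Open Scope classical_set_scope.
Local Open Scope ring_scope.

(** Both sides are governed by pointwise optimisation, so everything reduces to
    measurable selections.  An upper semicontinuous compact-valued map [F] meets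
    a closed set on a closed set of times; this weak measurability survives
    passing to the minimisers over [F t] of a function measurable in [t] and
    nonexpansive in the point, and minimising the coordinates one after another
    leaves a measurable selection.  Applied to [|v + w(t)|] over [A t] and to the
    distance from [- w] to [A t] over [B t], this yields measurable pointwise
    solutions, bounded because [A] and [B] are bounded on [[0, T]]; monotonicity
    of the integral then exchanges it with the maximum and the minimum. *)

(** * Euclidean norm and nonexpansive functions *)

Section EuclideanNorm.
Context {R : realType} {k : nat}.
Implicit Types (v w : 'rV[R]_k) (e : R).

Lemma sqnorm_ge0 v : 0 <= sqnorm v.
Proof. by apply: sumr_ge0 => i _; rewrite -expr2 sqr_ge0. Qed.

Lemma enorm_ge0 v : 0 <= enorm v.
Proof. exact: sqrtr_ge0. Qed.

Lemma sqr_enorm v : enorm v ^+ 2 = sqnorm v.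
Proof. by rewrite sqr_sqrtr// sqnorm_ge0. Qed.

Lemma enormN v : enorm (- v) = enorm v.
Proof.
by congr Num.sqrt; apply: eq_bigr => i _; rewrite mxE mulrNN.
Qed.

Lemma coord_le_enorm v i : `|v 0 i| <= enorm v.
Proof.
rewrite -(@ler_pXn2r _ 2)// ?nnegrE ?enorm_ge0// sqr_enorm real_normK ?num_real//.
rewrite /sqnorm /dotp (bigD1 i)//= -expr2 lerDl sumr_ge0// => j _.
by rewrite -expr2 sqr_ge0.
Qed.

(** Compares the Euclidean norm with the sup norm that defines the topology. The crude constant
    [k.+1] is positive even for [k = 0], so later radii can be divided by it. *)
Lemma enorm_le e v : 0 <= e -> (forall i, `|v 0 i| <= e) ->
  enorm v <= k.+1%:R * e.
Proof.
move=> e0 ve; rewrite -(@ler_pXn2r _ 2)// ?nnegrE ?enorm_ge0 ?mulr_ge0//.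
rewrite sqr_enorm (@le_trans _ _ (k%:R * e ^+ 2))//.
  rewrite mulr_natl -[in leRHS](card_ord k) -sumr_const; apply: ler_sum => i _.
  by rewrite -expr2 -real_normK ?num_real// ler_pXn2r ?nnegrE.
rewrite exprMn ler_wpM2r ?sqr_ge0// -natrX ler_nat.
by rewrite (leq_trans (leqnSn _))// expnS leq_pmulr.
Qed.

(** Cauchy-Schwarz: twice the gap, multiplied by [enorm v * enorm w], is the sum of the squares of
    [enorm w * v 0 i - enorm v * w 0 i]. If a norm vanishes, so do all coordinates of that
    vector. *)
Lemma dotp_le_enormM v w : dotp v w <= enorm v * enorm w.
Proof.
have [v0|v0] := eqVneq (enorm v) 0.
  rewrite v0 mul0r /dotp big1// => i _.
  have := coord_le_enorm v i; rewrite v0 normr_le0 => /eqP ->.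
  by rewrite mul0r.
have [w0|w0] := eqVneq (enorm w) 0.
  rewrite w0 mulr0 /dotp big1// => i _.
  have := coord_le_enorm w i; rewrite w0 normr_le0 => /eqP ->.
  by rewrite mulr0.
have ab0 : 0 < enorm v * enorm w.
  by rewrite mulr_gt0// lt_def enorm_ge0 ?v0 ?w0.
rewrite -subr_ge0 -(pmulr_rge0 _ ab0).
suff : 0 <= 2 * (enorm v * enorm w * (enorm v * enorm w - dotp v w)) by lra.
suff -> : 2 * (enorm v * enorm w * (enorm v * enorm w - dotp v w)) =
    \sum_i (enorm w * v 0 i - enorm v * w 0 i) ^+ 2.
  by apply: sumr_ge0 => i _; rewrite sqr_ge0.
transitivity (enorm w ^+ 2 * sqnorm v
    - 2 * (enorm v * enorm w) * dotp v w + enorm v ^+ 2 * sqnorm w).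
  by rewrite -!sqr_enorm; ring.
rewrite /sqnorm /dotp !mulr_sumr -sumrB -big_split/=.
by apply: eq_bigr => i _; ring.
Qed.

Lemma ler_enormD v w : enorm (v + w) <= enorm v + enorm w.
Proof.
rewrite -(@ler_pXn2r _ 2)// ?nnegrE ?addr_ge0 ?enorm_ge0//.
rewrite sqrrD !sqr_enorm.
have -> : sqnorm (v + w) = sqnorm v + dotp v w *+ 2 + sqnorm w.
  rewrite /sqnorm /dotp -mulr_natl mulr_sumr -!big_split/=.
  by apply: eq_bigr => i _; rewrite mxE; ring.
by rewrite lerD2r lerD2l lerMn2r/= dotp_le_enormM.
Qed.

Lemma ler_dist_enorm v w : `|enorm v - enorm w| <= enorm (v - w).
Proof.
rewrite ler_distl; apply/andP; split.
  rewrite lerBlDr -(enormN (v - w)) opprB.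
  by rewrite (le_trans _ (ler_enormD v (w - v)))// (addrC v) subrK.
by rewrite (le_trans _ (ler_enormD w (v - w)))// (addrC w) subrK.
Qed.

(** Every function minimised below is of this kind: translated norms, coordinates, distances to a
    set and their opposites. The constant 1 turns an error in the point into the same error in the
    value. *)
Definition nonexpansive (phi : 'rV[R]_k -> R) :=
  forall v w, `|phi v - phi w| <= enorm (v - w).

Lemma enorm_translate_nonexpansive w : nonexpansive (fun v => enorm (v + w)).
Proof.
by move=> v v'; rewrite (le_trans (ler_dist_enorm _ _))// opprD addrACA subrr addr0.
Qed.

Lemma coord_nonexpansive i : nonexpansive (fun v => v 0 i).
Proof.
by move=> v w; rewrite (le_trans _ (coord_le_enorm _ i))// !mxE.
Qed.

Lemma nonexpansiveN phi : nonexpansive phi -> nonexpansive (fun v => - phi v).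
Proof. by move=> nphi v w; rewrite -opprD normrN. Qed.

Lemma nonexpansive_continuous phi : nonexpansive phi -> continuous phi.
Proof.
move=> nphi v; apply/(@cvgrPdist_lt _ _ _ _ (nbhs_filter v)) => e e0.
(* A sup-norm ball of this radius has Euclidean radius at most [e / 2]; the factor 2 makes the final
   inequality strict. *)
have e1 : 0 < e / (2 * k.+1%:R) by rewrite divr_gt0// mulr_gt0.
near=> w.
rewrite (le_lt_trans (nphi _ _))//.
rewrite (@le_lt_trans _ _ (k.+1%:R * (e / (2 * k.+1%:R))))//.
  apply: enorm_le; first exact: ltW.
  move=> i; rewrite !mxE; apply: ltW.
  suff : ball v (e / (2 * k.+1%:R)) w by case => _; exact.
  near: w; exact: nbhsx_ballx.
have cancel (c : R) : c != 0 -> c * (e / (2 * c)) = e / 2 by move=> c0; field.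
by rewrite cancel//; lra.
Unshelve. all: by end_near. Qed.

Lemma rat_approx v e : 0 < e ->
  exists p : 'rV[rat]_k, enorm (v - map_mx ratr p) <= e.
Proof.
move=> e0; have e1 : 0 < e / k.+1%:R by rewrite divr_gt0.
have [p pP] : {p : 'I_k -> rat & forall i, `|v 0 i - ratr (p i)| <= e / k.+1%:R}.
  apply: (@choice _ _ (fun i q => `|v 0 i - ratr q| <= e / k.+1%:R)) => i.
  have [|q] := @rat_in_itvoo _ (v 0 i - e / k.+1%:R) (v 0 i + e / k.+1%:R).
    by move: (_ / _) e1 => c; lra.
  by rewrite in_itv/= => /andP[q1 q2]; exists q; rewrite ler_norml; move: (_ / _) q1 q2 => c; lra.
exists (\row_i p i); rewrite -[leRHS](@mulfVK _ k.+1%:R)// mulrC.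
by apply: enorm_le => [|i]; [exact: ltW|rewrite !mxE].
Qed.

End EuclideanNorm.

(** * Weakly measurable compact-valued maps and their measurable selections *)

Section MeasurableMultifunctions.
Context {R : realType} {k : nat} d (S : measurableType d).
Variables (D : set S) (mD : measurable D).
Implicit Types (F G : S -> set 'rV[R]_k) (phi : S -> 'rV[R]_k -> R).

(** Weak measurability is tested on closed sets, the form that upper semicontinuity yields
    directly. *)
Definition measurable_multifunction F :=
  [/\ forall t, D t -> compact (F t), forall t, D t -> F t !=set0 &
      forall C, closed C -> measurable (D `&` [set t | F t `&` C !=set0])].

Definition caratheodory_fun phi :=
  (forall t, D t -> nonexpansive (phi t)) /\
  (forall y, measurable_fun D (phi ^~ y)).

Lemma measurable_sublevel_le (f : S -> R) c :
  measurable_fun D f -> measurable (D `&` [set t | f t <= c]).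
Proof.
move=> mf; have := mf mD _ (measurable_itv `]-oo, c]).
by congr measurable; apply/seteqP; split => t [Dt]/=; rewrite in_itv/=.
Qed.

Lemma closed_nonexpansive_sublevel (f : 'rV[R]_k -> R) c :
  nonexpansive f -> closed [set y | f y <= c].
Proof.
move=> nf; have cf := nonexpansive_continuous nf.
by apply: (@preimage_closed _ _ f [set r | r <= c]) => [y _|];
  [exact: cf|exact: closed_le].
Qed.

Lemma compact_attains_min (K : set 'rV[R]_k) (f : 'rV[R]_k -> R) :
  K !=set0 -> compact K -> nonexpansive f -> exists c, is_min K f c.
Proof.
move=> K0 cK nf.
have [|c cK' cmin] := compact_EVT_min K0 cK (f := f).
  by apply: continuous_subspaceT; exact: nonexpansive_continuous.
exists (f c); split; first by exists c; rewrite // -inE.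
by move=> a Ka; apply: cmin; rewrite inE.
Qed.

(* By compactness of [F t], the condition on [t] holds iff for every [j] some
   rational [p] satisfies [phi t p <= c + 1/(j+1)] and has a point of
   [F t `&` C] within distance [1/(j+1)]. *)
Lemma measurable_meets_sublevel F phi (C : set 'rV[R]_k) c :
  measurable_multifunction F -> caratheodory_fun phi -> closed C ->
  measurable (D `&` [set t | exists y, [/\ F t y, C y & phi t y <= c]]).
Proof.
move=> [cF F0 mF] [nphi mphi] cC.
pose e (j : nat) : R := j.+1%:R^-1.
have e0 j : 0 < e j by rewrite invr_gt0.
pose P (p : 'rV[rat]_k) : 'rV[R]_k := map_mx ratr p.
pose H j p := (D `&` [set t |
    F t `&` (C `&` [set y | enorm (y + - P p) <= e j]) !=set0]) `&`
  (D `&` [set t | phi t (P p) <= c + e j]).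
have mH j p : measurable (H j p).
  apply: measurableI; last by apply: measurable_sublevel_le; exact: mphi.
  apply: mF; apply: closedI => //; apply: closed_nonexpansive_sublevel.
  exact: enorm_translate_nonexpansive.
rewrite [X in measurable X](_ : _ = \bigcap_j \bigcup_p H j p).
  apply: bigcap_measurableType => j _.
  exact: (countable_bigcupT_measurable (countableP _)).
apply/seteqP; split => [t [Dt [y [Fy Cy phiy]]] j _ | t Ht].
  have [p py] := rat_approx y (e0 j); exists p => //.
  split; split => //; first by exists y.
  have := nphi t Dt y (P p); rewrite ler_norml => /andP[h _] /=.
  by have : enorm (y - P p) <= e j := py; lra.
have [p0 _ [[Dt _] _]] := Ht 0 Logic.I.
split => //.
(* One [e j] comes from the value at the rational point, the other from moving from that point to
   [y]. *)
have step j : exists y, [/\ F t y, C y & phi t y <= c + 2 * e j].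
  have [p _ [[_ [y [Fy [Cy ye]]]] [_ /= pe]]] := Ht j Logic.I.
  exists y; split => //.
  have := nphi t Dt y (P p); rewrite ler_norml => /andP[_ h].
  have : enorm (y - P p) <= e j := ye; lra.
(* The points found for different [j] may differ; an attained minimum over the compact set [F t]&[C]
   lies below all their values, hence below [c]. *)
have [||b [[y [Fy Cy] yb] bmin]] :=
    @compact_attains_min (F t `&` C) (phi t) _ _ (nphi t Dt).
- by have [y [Fy Cy _]] := step 0; exists y.
- by apply: compact_closedI => //; exact: cF.
exists y; split => //; rewrite yb; apply/ler_addgt0Pr => r r0.
have [j jr] : exists j, 2 * e j <= r.
  have r2 : 0 < r / 2 by lra.
  have [j] := filter_ex (near_infty_natSinv_lt (PosNum r2)).
  by rewrite /= -/(e j) => jr; exists j; lra.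
have [y' [Fy' Cy' y'b]] := step j.
have : b <= phi t y' by exact: bmin.
lra.
Qed.

Definition argmin F phi t : set 'rV[R]_k :=
  [set y | F t y /\ forall y', F t y' -> phi t y <= phi t y'].

Lemma argmin_measurable F phi :
  measurable_multifunction F -> caratheodory_fun phi ->
  measurable_multifunction (argmin F phi).
Proof.
move=> MF Cphi; have [cF F0 mF] := MF; have [nphi mphi] := Cphi.
have amin t : D t -> exists c, is_min (F t) (phi t) c.
  by move=> Dt; apply: compact_attains_min; [exact: F0|exact: cF|exact: nphi].
split=> [t Dt|t Dt|C cC].
- have [c [[y Fy yc] cmin]] := amin t Dt.
  rewrite (_ : argmin F phi t = F t `&` [set z | phi t z <= c]).
    apply: compact_closedI; first exact: cF.
    by apply: closed_nonexpansive_sublevel; exact: nphi.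
  apply/seteqP; split => z [Fz zc]; split => //=; first by rewrite -yc zc.
  by move=> y' Fy'; rewrite (le_trans zc)// cmin.
- have [c [[y Fy yc] cmin]] := amin t Dt.
  by exists y; split => // y' Fy'; rewrite yc cmin.
pose lev E q := D `&` [set t | exists y, [/\ F t y, E y & phi t y <= ratr q]].
have mlev E q : closed E -> measurable (lev E q).
  by move=> cE; exact: measurable_meets_sublevel.
(* The minimisers avoid [C] iff a rational separates the minimum over [F t] from
   the minimum over [F t `&` C]. *)
rewrite [X in measurable X](_ : _ =
    D `\` \bigcup_q (lev setT q `\` lev C q)).
  apply: measurableD => //; apply: bigcupT_measurable_rat => q.
  by apply: measurableD; apply: mlev => //; exact: closedT.
apply/seteqP; split => [t [Dt [y [[Fy ymin] Cy]]]|t [Dt Nt]].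
  split => // -[q _ [[_ [y' [Fy' _ y'q]]] Nlev]]; apply: Nlev; split => //.
  by exists y; split => //; rewrite (le_trans (ymin _ Fy')).
split => //; have [c [[y Fy yc] cmin]] := amin t Dt.
apply: contrapT => NC; apply: Nt.
(* If [F t]&[C] is nonempty, its minimum exceeds [c] strictly, since no minimiser lies in [C], and
   [q] is taken between the two; otherwise any rational above [c] serves. *)
have [q cq Nq] : exists2 q, c < ratr q :> R &
    ~ exists y, [/\ F t y, C y & phi t y <= ratr q].
  have [FC0|FC0] := pselect (F t `&` C !=set0).
    have [||b [[y' [Fy' Cy'] y'b] bmin]] :=
      @compact_attains_min (F t `&` C) (phi t) _ _ (nphi t Dt) => //.
      by apply: compact_closedI => //; exact: cF.
    have cb : c < b.
      rewrite -y'b lt_def cmin// andbT; apply/eqP => y'c; apply: NC.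
      by exists y'; split => //; split => // z Fz; rewrite y'c cmin.
    have [q] := rat_in_itvoo cb; rewrite in_itv/= => /andP[cq qb].
    exists q => // -[z [Fz Cz zq]].
    by have := bmin z (conj Fz Cz); rewrite leNgt (le_lt_trans zq).
  have [q] := @rat_in_itvoo _ c (c + 1) ltac:(lra).
  rewrite in_itv/= => /andP[cq _]; exists q => // -[z [Fz Cz _]].
  by apply: FC0; exists z.
exists q => //; split; last by move=> [_].
by split => //; exists y; split => //; rewrite yc ltW.
Qed.

(** As the minimum is attained, [g t <= c] says exactly that [F t] meets the sublevel set of [phi t]
    at [c]. *)
Lemma measurable_min_value F phi (g : S -> R) :
  measurable_multifunction F -> caratheodory_fun phi ->
  (forall t, D t -> is_min (F t) (phi t) (g t)) -> measurable_fun D g.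
Proof.
move=> MF Cphi gmin _; apply: (measurability _ (RGenOInfty.measurableE R)) => //.
move=> _ [_ [c ->] <-].
rewrite [X in measurable X](_ : _ =
    D `\` (D `&` [set t | exists y, [/\ F t y, setT y & phi t y <= c]])).
  by apply: measurableD => //; apply: measurable_meets_sublevel => //; exact: closedT.
apply/seteqP; split => t [Dt] /=.
  rewrite in_itv/= andbT => cg; split => // -[_ [y [Fy _ yc]]].
  by have := (gmin t Dt).2 y Fy; rewrite leNgt (le_lt_trans yc).
move=> N; split => //; rewrite in_itv/= andbT ltNge; apply/negP => gc.
by apply: N; split => //; have [[y Fy yg] _] := gmin t Dt; exists y; rewrite yg.
Qed.

Lemma coord_caratheodory i : caratheodory_fun (fun _ y => y 0 i).
Proof.
by split => [t _|y]; [exact: coord_nonexpansive|exact: measurable_cst].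
Qed.

(* Minimising the coordinates in turn leaves only the lexicographically smallest
   point of [F t]. *)
Lemma measurable_selection F : measurable_multifunction F ->
  exists2 s : S -> 'rV[R]_k, (forall t, D t -> F t (s t)) &
    forall i, measurable_fun D (fun t => s t 0 i).
Proof.
suff lex (l : seq 'I_k) F' : measurable_multifunction F' ->
    exists G, [/\ measurable_multifunction G, forall t, G t `<=` F' t &
      forall i t y y', i \in l -> D t -> G t y -> G t y' -> y 0 i = y' 0 i].
  move=> /(lex (enum 'I_k))[G [MG GF Geq]]; have [_ G0 _] := MG.
  have [s sG] : {s : S -> 'rV[R]_k & forall t, D t -> G t (s t)}.
    apply: (@choice _ _ (fun t y => D t -> G t y)) => t.
    have [Dt|nDt] := pselect (D t); last by exists 0.
    by have [y Gy] := G0 t Dt; exists y.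
  exists s => [t Dt|i]; first by apply: GF; exact: sG.
  (* Although [s] comes from an arbitrary choice, each coordinate is constant on [G t], so it equals
     the minimum of that coordinate over [G t]. *)
  apply: (measurable_min_value MG (coord_caratheodory i)) => t Dt; split.
    by exists (s t) => //; exact: sG.
  move=> y Gy; rewrite (Geq i t (s t) y) ?mem_enum//; exact: sG.
elim: l F' => {F} [|i l IH] F MF; first by exists F; split => // t.
have [G [MG GF Geq]] := IH _ (argmin_measurable MF (coord_caratheodory i)).
exists G; split => // [t y /GF[]//|j t y y'].
rewrite inE => /predU1P[->|jl] Dt Gy Gy'; last exact: (Geq j t).
have [Fy ymin] := GF _ _ Gy; have [Fy' y'min] := GF _ _ Gy'.
by apply/eqP; rewrite eq_le ymin//= y'min.
Qed.

End MeasurableMultifunctions.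

(** * Extremal values and the Hausdorff deviation *)

Lemma is_min_unique dsp (K : porderType dsp) (X : Type) (A : set X)
    (F : X -> K) c c' :
  is_min A F c -> is_min A F c' -> c = c'.
Proof.
move=> [[a Aa <-] amin] [[b Ab <-] bmin].
by apply/eqP; rewrite eq_le amin// bmin.
Qed.

Lemma is_maxmin_ge dsp (K : porderType dsp) (X Y : Type) (W : set X)
    (V : set Y) (F : X -> Y -> K) c w c' :
  is_maxmin W V F c -> W w -> is_min V (F w) c' -> (c' <= c)%O.
Proof.
move=> [g gmin [_ gmax]] Ww c'min.
by rewrite (is_min_unique c'min (gmin w Ww)) gmax.
Qed.

Section EuclideanMaxMin.
Context {R : realType} {k : nat}.
Implicit Types (A B : set 'rV[R]_k) (w y : 'rV[R]_k).

Lemma is_min_sqnorm A y c : is_min A (fun a => enorm (a + y)) c ->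
  is_min A (fun a => sqnorm (a + y)) (c ^+ 2).
Proof.
move=> [[a Aa <-] amin]; split; first by exists a; rewrite // sqr_enorm.
by move=> b Ab; rewrite -sqr_enorm ler_pXn2r ?nnegrE ?enorm_ge0// amin.
Qed.

(** The square root is monotone, and the distance from [- b] to [a] is the norm of [a + b]. *)
Lemma hausdorff_dev_of_maxmin A B c :
  is_maxmin B A (fun w v => sqnorm (v + w)) c ->
  is_hausdorff_dev [set - w | w in B] A (Num.sqrt c).
Proof.
move=> [g gmin [[w Bw gw] gmax]].
have enormE (b a : 'rV[R]_k) : enorm (- b - a) = Num.sqrt (sqnorm (a + b)).
  by rewrite -opprD enormN addrC.
exists (fun b => Num.sqrt (g (- b))) => [_ [b Bb <-]|].
  rewrite opprK; have [[a Aa ab] amin] := gmin b Bb.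
  split; first by exists a; rewrite // enormE ab.
  by move=> a' Aa'; rewrite enormE ler_wsqrtr ?amin.
split; first by exists (- w); [exists w|rewrite opprK gw].
by move=> _ [b Bb <-]; rewrite opprK ler_wsqrtr ?gmax.
Qed.

End EuclideanMaxMin.

(** * Exchange of the integral with the maximum and the minimum *)

Section Interchange.
Context {R : realType} {k : nat} d (S : measurableType d).
Variables (D : set S) (mD : measurable D).
Implicit Types (A B : S -> set 'rV[R]_k) (v w : S -> 'rV[R]_k).

Local Notation q := (fun w v : 'rV[R]_k => sqnorm (v + w)).

Definition measurable_vec v := forall i, measurable_fun D (fun t => v t 0 i).

(** Only measurability is required here; for uniformly bounded values these become the selections in
    the sub- and superdifferential. *)
Definition selections A : set (S -> 'rV[R]_k) :=
  [set v | measurable_vec v /\ forall t, D t -> A t (v t)].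

Lemma measurable_sqnorm v w : measurable_vec v -> measurable_vec w ->
  measurable_fun D (fun t => sqnorm (v t + w t)).
Proof.
move=> mv mw; apply: measurable_sum => i.
apply: (eq_measurable_fun (fun t => (v t 0 i + w t 0 i) ^+ 2)).
  by move=> t _; rewrite mxE expr2.
by apply: measurable_funX; apply: measurable_funD.
Qed.

Lemma enorm_caratheodory w : measurable_vec w ->
  caratheodory_fun D (fun t y => enorm (y + w t)).
Proof.
move=> mw; split => [t _|y]; first exact: enorm_translate_nonexpansive.
apply: (measurableT_comp (f := @Num.sqrt R)).
  by apply: continuous_measurable_fun; exact: sqrt_continuous.
by apply: measurable_sqnorm => // i; exact: measurable_cst.
Qed.

(** Selects measurably a point of [A t] nearest to [- w t]. *)
Lemma measurable_projection A w : measurable_multifunction D A ->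
  measurable_vec w ->
  exists2 v, selections A v &
    forall t, D t -> is_min (A t) (q (w t)) (q (w t) (v t)).
Proof.
move=> MA mw; have Cw := enorm_caratheodory mw.
have [v vA mv] := measurable_selection mD (argmin_measurable mD MA Cw).
exists v; first by split => // t /vA[].
move=> t /vA[At vmin]; rewrite -sqr_enorm; apply: is_min_sqnorm.
by split; first exists (v t).
Qed.

(** Here [g t y] is the distance from [- y] to [A t]. It is nonexpansive because a nearest point for
    one argument can be tested at the other, and measurable in [t] as a minimum value. *)
Lemma distance_caratheodory A : measurable_multifunction D A ->
  exists2 g : S -> 'rV[R]_k -> R,
    (forall t y, D t -> is_min (A t) (fun a => enorm (a + y)) (g t y)) &
    caratheodory_fun D g.
Proof.
move=> MA; have [cA A0 _] := MA.
have [g gmin] : {g : S * 'rV[R]_k -> R & forall p, D p.1 ->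
    is_min (A p.1) (fun a => enorm (a + p.2)) (g p)}.
  apply: (@choice _ _ (fun p c => D p.1 ->
    is_min (A p.1) (fun a => enorm (a + p.2)) c)) => -[t y] /=.
  have [Dt|nDt] := pselect (D t); last by exists 0.
  have [c cmin] := compact_attains_min (A0 t Dt) (cA t Dt)
    (enorm_translate_nonexpansive y).
  by exists c.
exists (fun t y => g (t, y)) => [t y Dt|]; first exact: (gmin (t, y)).
split=> [t Dt y y'|y].
  have half y1 y2 : g (t, y1) <= g (t, y2) + enorm (y1 - y2).
    have [[a Aa <-] _] := gmin (t, y2) Dt; have [_ gle] := gmin (t, y1) Dt.
    apply: le_trans (gle a Aa) _ => /=.
    have -> : a + y1 = (a + y2) + (y1 - y2) by rewrite addrACA subrr addr0 addrC.
    exact: ler_enormD.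
  rewrite ler_distl lerBlDr half andbT.
  by rewrite -(opprB y') enormN half.
have mc : measurable_vec (fun=> y) by move=> i; exact: measurable_cst.
by apply: (measurable_min_value mD MA (enorm_caratheodory mc)) => t;
  exact: (gmin (t, y)).
Qed.

(** Maximising the distance is minimising its opposite, so the selection of minimisers gives [w];
    then [v] is the projection for this [w]. *)
Lemma measurable_maxmin_solution A B :
  measurable_multifunction D A -> measurable_multifunction D B ->
  exists w v, [/\ measurable_vec w, measurable_vec v &
    forall t, D t -> solves_maxmin (B t) (A t) q (w t) (v t)].
Proof.
move=> MA MB; have [g gmin [ng mg]] := distance_caratheodory MA.
have CNg : caratheodory_fun D (fun t y => - g t y).
  split => [t Dt|y]; first by apply: nonexpansiveN; exact: ng.
  by apply: (@measurable_funN _ _ _ _ (g ^~ y)); exact: mg.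
have [w wB mw] := measurable_selection mD (argmin_measurable mD MB CNg).
have [v [mv vA] vmin] := measurable_projection MA mw.
exists w, v; split => // t Dt; have [Bw wmax] := wB t Dt.
have g2min y : is_min (A t) (q y) (g t y ^+ 2).
  by apply: is_min_sqnorm; exact: gmin.
split => //; [exact: vA|exact: vmin|exists (fun y => g t y ^+ 2) => //].
rewrite (is_min_unique (vmin t Dt) (g2min (w t))).
split; first by exists (w t).
move=> y By; have gge0 y' : 0 <= g t y'.
  by have [[a _ <-] _] := gmin t y' Dt; exact: enorm_ge0.
by rewrite ler_pXn2r ?nnegrE// -lerN2 wmax.
Qed.

Variable mu : {measure set S -> \bar R}.

Let J w v := (\int[mu]_(t in D) (sqnorm (v t + w t))%:E)%E.

Let le_J w v w' v' : measurable_vec w -> measurable_vec v ->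
  measurable_vec w' -> measurable_vec v' ->
  (forall t, D t -> sqnorm (v t + w t) <= sqnorm (v' t + w' t)) ->
  (J w v <= J w' v')%E.
Proof.
move=> mw mv mw' mv' le; apply: ge0_le_integral => //.
- by move=> t _; rewrite lee_fin sqnorm_ge0.
- by apply/measurable_EFinP; exact: measurable_sqnorm.
- by apply/measurable_EFinP; exact: measurable_sqnorm.
Qed.

(** A pointwise minimiser minimises the integral by monotonicity. A competitor [w'] has its inner
    minimum at a measurable projection, where the integrand is at most the pointwise max-min value,
    that is, the integrand of [J w v]. *)
Theorem pointwise_maxmin_solves A B w v :
  measurable_multifunction D A -> measurable_vec w -> measurable_vec v ->
  (forall t, D t -> solves_maxmin (B t) (A t) q (w t) (v t)) ->
  solves_maxmin (selections B) (selections A) J w v.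
Proof.
move=> MA mw mv sol.
have SB : selections B w by split => // t /sol[].
have SA : selections A v by split => // t /sol[].
have minJ w' v' : measurable_vec w' -> selections A v' ->
    (forall t, D t -> is_min (A t) (q (w' t)) (q (w' t) (v' t))) ->
    is_min (selections A) (J w') (J w' v').
  move=> mw' Av' v'min; split; first by exists v'.
  move=> a [ma aA]; apply: le_J => //; first exact: Av'.1.
  by move=> t Dt; have [_ ->] := v'min t Dt; last exact: aA.
have vmin : is_min (selections A) (J w) (J w v).
  by apply: minJ => // t /sol[].
split => //.
(* The max-min predicate asks for the inner minimum as a function of [w'], so a projection is fixed
   for all [w'] at once, with the dummy value 0 if [w'] is not measurable. *)
have [pr prP] : {pr : (S -> 'rV[R]_k) -> S -> 'rV[R]_k & forall w', measurable_vec w' ->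
    selections A (pr w') /\
    forall t, D t -> is_min (A t) (q (w' t)) (q (w' t) (pr w' t))}.
  apply: (@choice _ _ (fun w' v' => measurable_vec w' -> selections A v' /\
    forall t, D t -> is_min (A t) (q (w' t)) (q (w' t) (v' t)))) => w'.
  have [mw'|nmw'] := pselect (measurable_vec w'); last by exists 0.
  by have [v' Av' v'min] := measurable_projection MA mw'; exists v'.
exists (fun w' => J w' (pr w')) => [w' [mw' _]|].
  by have [Ap pmin] := prP w' mw'; exact: minJ.
split.
  (* [pr w] may differ from [v], but both attain the same inner minimum. *)
  exists w => //; have [Ap pmin] := prP w mw.
  exact: (is_min_unique (minJ w (pr w) mw Ap pmin) vmin).
move=> w' [mw' Bw']; have [[mp Ap] pmin] := prP w' mw'.
apply: le_J => // t Dt; have [_ _ _ mm] := sol t Dt.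
exact: (is_maxmin_ge mm (Bw' t Dt) (pmin t Dt)).
Qed.

End Interchange.

(** * Compactness of Minkowski sums and convex hulls *)

Section CompactConvexSets.
Context {R : realType}.

Lemma image_compact (U V : topologicalType) (f : U -> V) (K : set U) :
  continuous f -> compact K -> compact (f @` K).
Proof.
by move=> cf cK; apply: continuous_compact => //; exact: continuous_subspaceT.
Qed.

Context {k : nat}.
Local Notation E := 'rV[R]_k.
Implicit Types (A B : set E).

Lemma image2_add A B :
  addset A B = (fun p : E * E => p.1 + p.2) @` (A `*` B).
Proof.
apply/seteqP; split => [_ [a Aa [b Bb <-]]|_ [[a b] [Aa Bb] <-]].
  by exists (a, b).
by exists a => //; exists b.
Qed.

Lemma addset_compact A B : compact A -> compact B -> compact (addset A B).
Proof.
move=> cA cB; rewrite image2_add; apply: image_compact.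
  exact: add_continuous.
exact: compact_setX.
Qed.

Lemma addset_nonempty A B : A !=set0 -> B !=set0 -> addset A B !=set0.
Proof. by move=> [a Aa] [b Bb]; exists (a + b), a => //; exists b. Qed.

(** The sum is a continuous image of a product of compact sets, compact by Tychonoff's theorem. *)
Lemma sumset_compact (I : finType) (A : I -> set E) :
  (forall i, compact (A i)) -> compact (sumset A).
Proof.
move=> cA.
rewrite (_ : sumset A = (fun f : prod_topology (fun _ : I => E) => \sum_i f i) @`
    [set f : prod_topology (fun _ : I => E) | forall i, A i (f i)]).
  apply: image_compact; last exact: tychonoff.
  have cadd : continuous (fun p : E * E => p.1 + p.2) by exact: add_continuous.
  move=> f; have := @cvg_big E I +%R 0 xpredT cadd _ (nbhs f)
    (index_enum I) (fun i g => g i) f (nbhs_filter f); apply => i _.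
  exact: (@proj_continuous _ (fun _ : I => E) i f).
apply/seteqP; split => [v [a Aa ->]|_ [a Aa <-]]; by exists a.
Qed.

Lemma sumset_nonempty (I : finType) (A : I -> set E) :
  (forall i, A i !=set0) -> sumset A !=set0.
Proof.
move=> A0; exists (\sum_i xget 0 (A i)), (fun i => xget 0 (A i)) => // i.
by have [a Aa] := A0 i; exact: (xgetI 0 Aa).
Qed.

(** Convexity with weights that need not sum to 1; when both vanish, any point of [A] serves. *)
Lemma convex_set_combine A a a' (s t : R) : convex_set A -> A a -> A a' ->
  0 <= s -> 0 <= t -> exists2 b, A b & s *: a + t *: a' = (s + t) *: b.
Proof.
move=> cvA Aa Aa' s0 t0.
have [st0|st0] := eqVneq (s + t) 0.
  exists a => //; have -> : s = 0 by lra. have -> : t = 0 by lra.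
  by rewrite !addr0 !scale0r addr0.
have stgt0 : 0 < s + t by rewrite lt_def st0 addr_ge0.
have l0 : 0 <= s / (s + t) by rewrite divr_ge0// ltW.
have l1 : s / (s + t) <= 1 by rewrite ler_pdivrMr// mul1r lerDl.
exists ((s / (s + t)) *: a + (1 - s / (s + t)) *: a').
  by have := cvA a a' (Itv01 l0 l1); rewrite !inE; exact.
rewrite scalerDr !scalerA; congr (_ *: _ + _ *: _); first by rewrite mulrC divfK.
by field.
Qed.

(** Written as the image of a product with the unit interval, so that compactness is inherited. *)
Definition segments A B : set E :=
  (fun p : R * (E * E) => p.1 *: p.2.1 + (1 - p.1) *: p.2.2) @`
    (`[0, 1] `*` (A `*` B)).

(** The union of segments lies in every convex set containing [A] and [B], and is itself convex: in
    a combination of two of its points, the parts in [A] and those in [B] are merged separately. *)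
Lemma co_segments A B : convex_set A -> convex_set B ->
  A !=set0 -> B !=set0 -> co A B = segments A B.
Proof.
move=> cvA cvB [a0 Aa0] [b0 Bb0]; apply/seteqP; split; last first.
  move=> _ [[l [a b]] [/= l01 [Aa Bb]] <-] C [cvC ABC] /=.
  move: l01; rewrite in_itv/= => /andP[l0 l1].
  have := cvC a b (Itv01 l0 l1); rewrite !inE; apply.
    by apply: ABC; left.
  by apply: ABC; right.
apply: smallest_sub => [|c [Ac|Bc]].
- move=> c c' l; rewrite !inE => -[[s [a b]] [/= s01 [Aa Bb]] <-].
  move=> [[s' [a' b']] [/= s'01 [Aa' Bb']] <-].
  move: s01 s'01; rewrite !in_itv/= => /andP[s0 s1] /andP[s'0 s'1].
  have l0 : 0 <= l%:num by []. have l1 : l%:num <= 1 by [].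
  have l1' : 0 <= 1 - l%:num by lra.
  have [||a2 Aa2 Ea2] := @convex_set_combine A a a' (l%:num * s)
    ((1 - l%:num) * s') cvA Aa Aa'; rewrite ?mulr_ge0//.
  have [||b2 Bb2 Eb2] := @convex_set_combine B b b' (l%:num * (1 - s))
    ((1 - l%:num) * (1 - s')) cvB Bb Bb'; rewrite ?mulr_ge0//; try lra.
  exists (l%:num * s + (1 - l%:num) * s', (a2, b2)).
    split => //=; rewrite in_itv/=; apply/andP; split.
      by rewrite addr_ge0// mulr_ge0.
    have : l%:num * s <= l%:num by rewrite ler_piMr.
    have : (1 - l%:num) * s' <= 1 - l%:num by rewrite ler_piMr.
    lra.
  rewrite /= -Ea2.
  have -> : 1 - (l%:num * s + (1 - l%:num) * s') =
      l%:num * (1 - s) + (1 - l%:num) * (1 - s') by ring.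
  rewrite -Eb2 /conv/= !scalerDr !scalerA addrACA.
  by [].
(* A point of one set is the end of a segment; [b0], and [a0] below, only provide the other end. *)
- exists (1, (c, b0)); last by rewrite /= subrr scale0r addr0 scale1r.
  by split => //=; rewrite in_itv/= ler01 lexx.
- exists (0, (a0, c)); last by rewrite /= subr0 scale0r add0r scale1r.
  by split => //=; rewrite in_itv/= ler01 lexx.
Qed.

Lemma co_compact A B : convex_set A -> convex_set B ->
  A !=set0 -> B !=set0 -> compact A -> compact B -> compact (co A B).
Proof.
move=> cvA cvB A0 B0 cA cB; rewrite co_segments//; apply: image_compact.
  have c21 : continuous (fun p : R * (E * E) => p.2.1).
    move=> p; apply: (@cvg_comp _ _ _ snd fst _ (nbhs p.2)).
      exact: cvg_snd.
    exact: cvg_fst.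
  have c22 : continuous (fun p : R * (E * E) => p.2.2).
    move=> p; apply: (@cvg_comp _ _ _ snd snd _ (nbhs p.2)).
      exact: cvg_snd.
    exact: cvg_snd.
  move=> p; apply: cvgD; apply: cvgZ.
  - exact: cvg_fst.
  - exact: c21.
  - exact: (cvgB (cvg_cst _) cvg_fst).
  - exact: c22.
by apply: compact_setX; [exact: segment_compact|exact: compact_setX].
Qed.

Lemma co_nonempty A B : A !=set0 -> co A B !=set0.
Proof. by move=> [a Aa]; exists a; apply: sub_gen_smallest; left. Qed.

End CompactConvexSets.

Lemma convex_set_affine_image (R : realType) (U V : lmodType R) (f : U -> V)
    (A : set U) :
  (forall (l : R) x y, f (l *: x + (1 - l) *: y) = l *: f x + (1 - l) *: f y) ->
  convex_set A -> convex_set (f @` A).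
Proof.
move=> faff cvA _ _ l /set_mem[a Aa <-] /set_mem[b Bb <-].
apply/mem_set; exists (l%:num *: a + (1 - l%:num) *: b); last exact: faff.
by have := cvA a b l; rewrite !inE; exact.
Qed.

Lemma convex_set1 (R : realType) (V : lmodType R) (c : V) :
  convex_set [set c].
Proof.
move=> _ _ l /set_mem-> /set_mem->; apply/mem_set.
by rewrite /conv/= -scalerDl addrCA subrr addr0 scale1r.
Qed.

(** * Upper semicontinuous maps: measurability and boundedness *)

Section UpperSemicontinuity.
Context {R : realType} {k : nat}.
Variables (T : R) (F : R -> set 'rV[R]_k).
Hypotheses (uscF : upper_semicontinuous T F)
  (cF : forall t, t \in `[0, T] -> compact (F t))
  (F0 : forall t, t \in `[0, T] -> F t !=set0).

(** Around each point of [K] some radius avoids [C]; the near-covering form of compactness makes it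
    uniform. *)
Lemma compact_separated (K C : set 'rV[R]_k) : compact K -> closed C ->
  ~ (K `&` C !=set0) ->
  exists2 r : R, 0 < r & forall a y, K a -> enorm (y - a) < r -> ~ C y.
Proof.
move=> /compact_near_coveringP cK cC KC.
have : \forall r \near 0^'+, K `<=` fun a => forall y, enorm (y - a) < r -> ~ C y.
  apply: (cK R 0^'+ (fun r a => forall y, enorm (y - a) < r -> ~ C y)).
  move=> a Ka.
  have /nbhs_ballP[e e0 eC] : nbhs a (~` C).
    apply: open_nbhs_nbhs; split; first exact: closed_openC.
    by move=> Ca; apply: KC; exists a.
  (* Half of [e] is spent on moving [a] within [K], half on the distance from there to [y]. *)
  have e20 : 0 < e / 2 by rewrite divr_gt0.
  exists (ball a (e / 2), [set r | r < e / 2]).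
    by split; [exact: nbhsx_ballx|exact: nbhs_right_lt].
  move=> [a' r] /= [aa' re] y ya'; apply: eC.
  rewrite [e]splitr; apply: (@ball_triangle _ _ a') => //.
  split=> [//|i j]; rewrite (ord1 i) /ball/= distrC.
  have := coord_le_enorm (y - a') j; rewrite !mxE => /le_lt_trans; apply.
  exact: lt_trans re.
move=> near_r; have [r [r0 Kr]] := filter_ex (filterI (nbhs_right_gt 0) near_r).
by exists r => // a y Ka; exact: Kr.
Qed.

(** If [F t] missed [C], a whole neighbourhood of [F t] would, and with it all [F s] for [s] near
    [t]; so [t] could not be a limit of times at which [C] is met. *)
Lemma usc_closed_meets (C : set 'rV[R]_k) : closed C ->
  closed (`[0, T] `&` [set t | F t `&` C !=set0]).
Proof.
move=> cC t clt.
have tT : t \in `[0, T].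
  have : closed (`[0, T] : set R) by exact: itv_closed.
  apply; apply: closureS clt; exact: subIsetl.
split => //; apply: contrapT => FC.
have [r r0 rC] := compact_separated (cF tT) cC FC.
have [e e0 eF] := uscF tT r0.
have [s [[sT [y [Fy Cy]]]]] := clt _ (nbhsx_ballx t e e0).
rewrite /ball/= distrC => ts.
have [a Fa ya] := eF s sT ts y Fy.
exact: (rC a y Fa ya Cy).
Qed.

(** Near [t] the values stay within 1 of [F t]; compactness of the interval turns these local bounds
    into one. *)
Lemma usc_bounded : exists M, forall t y, t \in `[0, T] -> F t y -> enorm y <= M.
Proof.
have := @segment_compact R 0 T; rewrite compact_near_coveringP => cT.
have : \forall M \near +oo, `[0, T] `<=`
    fun t => t \in `[0, T] -> forall y, F t y -> enorm y <= M.
  apply: (cT R +oo (fun M t => t \in `[0, T] -> forall y, F t y -> enorm y <= M)).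
  move=> t tT.
  have nen : nonexpansive (fun y : 'rV[R]_k => - enorm y).
    apply: nonexpansiveN => v w; exact: ler_dist_enorm.
  (* [- c] is the largest norm on [F t]. *)
  have [c [_ cmin]] := compact_attains_min (F0 tT) (cF tT) nen.
  have [e e0 eF] := uscF tT ltr01.
  exists (ball t e, [set M | - c + 1 < M]).
    by split; [exact: nbhsx_ballx|exact: (nbhs_pinfty_gt (num_real _))].
  move=> [s M] /= [ts cM] sT y Fy; rewrite /ball/= distrC in ts.
  have [a Fa ya] := eF s sT ts y Fy.
  have := ler_enormD a (y - a); rewrite (addrC a) subrK.
  have := cmin a Fa; lra.
move=> /filter_ex[M MF]; exists M => t y tT; exact: MF.
Qed.

Lemma measurable_lebesgueR (X : set R) :
  measurable X -> measurable (X : set (lebesgueR R)).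
Proof. exact: sub_caratheodory. Qed.

Lemma usc_measurable_multifunction :
  measurable_multifunction (`[0, T] : set (lebesgueR R)) F.
Proof.
split=> [t tT|t tT|C cC]; [exact: cF|exact: F0|].
by apply: measurable_lebesgueR; apply: closed_measurable; exact: usc_closed_meets.
Qed.

End UpperSemicontinuity.

(** * Bounded measurable functions as elements of the space of essentially bounded ones *)

Section BoundedSelections.
Context {R : realType} {k : nat}.
Variable T : R.

Lemma measurable_segment : measurable (`[0, T] : set (lebesgueR R)).
Proof. by apply: measurable_lebesgueR; exact: measurable_itv. Qed.

Lemma in_Linfty_measurable (v : R -> 'rV[R]_k) : in_Linfty T v -> vmeasurable T v.
Proof.
move=> Lv i; have := Lv i; rewrite inE => /andP[/set_mem mv _].
exact/(measurable_restrictT _ measurable_segment).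
Qed.

Lemma bounded_in_Linfty (v : R -> 'rV[R]_k) M : vmeasurable T v ->
  (forall t, t \in `[0, T] -> enorm (v t) <= M) -> in_Linfty T v.
Proof.
move=> mv vM i; rewrite inE; apply/andP; split; rewrite inE/=.
  exact/(measurable_restrictT _ measurable_segment).
rewrite /finite_norm unlock /Lnorm.
(* The maximum with 0 covers the extension by 0 outside the interval. *)
case: ifPn => // _; apply: (@le_lt_trans _ _ (Num.max 0 M)%:E); last exact: ltry.
apply/ess_supP; apply: aeW => t /=; rewrite lee_fin patchE.
case: ifPn => [/set_mem tT|_]; last by rewrite normr0 le_max lexx.
rewrite le_max; apply/orP; right.
exact: le_trans (coord_le_enorm _ _) (vM t tT).
Qed.

End BoundedSelections.

(** * Compactness and nonemptiness of the pointwise sub- and superdifferentials *)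

Section SubdifferentialCompactness.
Context {R : realType} {n m : nat}.
Variables (T : R) (x0 xT : 'rV[R]_n) (ulo uup : 'rV[R]_m).
Variable f : 'rV[R]_n -> 'rV[R]_m -> R -> 'rV[R]_n.
Variables subf supf :
  'I_n -> 'rV[R]_n -> 'rV[R]_m -> R -> set 'rV[R]_(n + m).
Variables (x z : R -> 'rV[R]_n) (u : R -> 'rV[R]_m).
Local Notation E := 'rV[R]_(n + n + m).

(** Convexity and nonemptiness are carried along because the hull of two such sets is compact
    through its description by segments. *)
Definition compact_convex (k : nat) (K : set 'rV[R]_k) :=
  [/\ convex_set K, compact K & K !=set0].

Lemma compact_convex1 k (c : 'rV[R]_k) : compact_convex [set c].
Proof.
split; [exact: convex_set1|exact: compact_set1|by exists c].
Qed.

Lemma compact_convex_affine (k l : nat) (g : 'rV[R]_k -> 'rV[R]_l) K :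
  continuous g ->
  (forall (s : R) a b, g (s *: a + (1 - s) *: b) = s *: g a + (1 - s) *: g b) ->
  compact_convex K -> compact_convex (g @` K).
Proof.
move=> cg ag [cvK cK [a Ka]]; split.
- exact: convex_set_affine_image.
- exact: image_compact.
- by exists (g a), a.
Qed.

Lemma emb_continuous : continuous (@emb R n m).
Proof.
move=> v P /nbhs_ballP[e /= e0 eP]; apply/nbhs_ballP; exists e => //= w vw.
apply: eP; case: vw => _ vw; split => // i j; rewrite (ord1 i).
rewrite /emb !mxE; case: (fintype.split j) => [j'|j']; rewrite !mxE; last exact: vw.
case: (fintype.split j') => l; rewrite !mxE; first exact: vw.
exact: ballxx.
Qed.

Lemma emb_affine (s : R) (a b : 'rV[R]_(n + m)) :
  emb (s *: a + (1 - s) *: b) = s *: emb a + (1 - s) *: emb b.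
Proof.
apply/rowP => j; rewrite /emb !mxE; case: (fintype.split j) => [j'|j']; rewrite !mxE//.
by case: (fintype.split j') => l; rewrite !mxE// !mulr0 addr0.
Qed.

(** Covers all the pieces of the first summand, with [c] equal to 1, -1, 2 or -2. *)
Lemma compact_convex_translate_scale (e : E) (c : R) K :
  compact_convex K -> compact_convex [set e + c *: w | w in K].
Proof.
have cg : continuous (fun w : E => e + c *: w).
  move=> w; apply: (@cvgD R E E (nbhs w)); first exact: cvg_cst.
  exact: scaler_continuous.
by apply: compact_convex_affine => // s a b; apply/rowP => j; rewrite !mxE; ring.
Qed.

Lemma compact_convex_co (K L : set E) : compact_convex K -> compact_convex L ->
  compact (co K L) /\ co K L !=set0.
Proof.
move=> [cvK cK K0] [cvL cL L0].
by split; [exact: co_compact|exact: co_nonempty].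
Qed.

Variable t : R.
Hypothesis hfq : forall i, is_quasidifferential (fun y c => f y c t 0 i) (x t) (u t)
  (subf i (x t) (u t) t) (supf i (x t) (u t) t).

Lemma subF_compact_convex i : compact_convex (subF subf x u t i).
Proof.
apply: compact_convex_affine; [exact: emb_continuous|exact: emb_affine|].
have [cv c _ _ ex] := hfq i; split => //.
(* The maximum in the zero direction is attained, which gives a point of the set. *)
by have [M [N [[[a aL _] _] _ _]]] := ex 0 0; exists a.
Qed.

Lemma supF_compact_convex i : compact_convex (supF supf x u t i).
Proof.
apply: compact_convex_affine; [exact: emb_continuous|exact: emb_affine|].
have [_ _ cv c ex] := hfq i; split => //.
by have [M [N [_ [[a aL _] _] _]]] := ex 0 0; exists a.
Qed.

Let sum_compact_nonempty (I : finType) (K : I -> set E) :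
  (forall i, compact (K i) /\ K i !=set0) ->
  compact (sumset K) /\ sumset K !=set0.
Proof.
by move=> KP; split; [apply: sumset_compact|apply: sumset_nonempty] => i;
  have [] := KP i.
Qed.

Let add_compact_nonempty (K L : set E) :
  compact K /\ K !=set0 -> compact L /\ L !=set0 ->
  compact (addset K L) /\ addset K L !=set0.
Proof.
by move=> [cK K0] [cL L0]; split; [exact: addset_compact|exact: addset_nonempty].
Qed.

Let set1_compact_nonempty (c : E) : compact [set c] /\ [set c] !=set0.
Proof. by have [] := compact_convex1 c. Qed.

Let imageE (K : set E) (e : E) (c : R) (g : E -> E) :
  (forall w, g w = e + c *: w) -> compact_convex K -> compact_convex (g @` K).
Proof.
by move=> /funext ->; exact: compact_convex_translate_scale.
Qed.

Lemma subphi_compact_nonempty :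
  compact (subphi T x0 xT ulo uup f subf supf x z u t) /\
  subphi T x0 xT ulo uup f subf supf x z u t !=set0.
Proof.
have set1P := set1_compact_nonempty.
apply: add_compact_nonempty; last exact: set1P.
apply: add_compact_nonempty.
  apply: add_compact_nonempty; last exact: set1P.
  apply: sum_compact_nonempty => i.
  have Ksub := subF_compact_convex i; have Ksup := supF_compact_convex i.
  case: ifP => _; [|case: ifP => _].
  - have [] // : compact_convex [set @e_ R n m i - w | w in supF supf x u t i].
    by apply: (@imageE _ (@e_ R n m i) (-1)) => // w; rewrite scaleN1r.
  - have [] // : compact_convex [set - @e_ R n m i + v | v in subF subf x u t i].
    by apply: (@imageE _ (- @e_ R n m i) 1) => // w; rewrite scale1r.
  - apply: compact_convex_co.
      by apply: (@imageE _ (@e_ R n m i) (-2)) => // w; rewrite scaleNr.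
    by apply: (@imageE _ (- @e_ R n m i) 2).
apply: sum_compact_nonempty => j; apply: add_compact_nonempty.
  do 2! [case: ifP => _; first exact: set1P].
  by apply: compact_convex_co; exact: compact_convex1.
do 2! [case: ifP => _; first exact: set1P].
by apply: compact_convex_co; exact: compact_convex1.
Qed.

Lemma supphi_compact_nonempty :
  compact (supphi f subf supf x z u t) /\ supphi f subf supf x z u t !=set0.
Proof.
(* The last three summands are the singleton of 0, which leaves the first. *)
do 3! [apply: add_compact_nonempty; last exact: set1_compact_nonempty].
apply: sum_compact_nonempty => i.
have Ksub := subF_compact_convex i; have Ksup := supF_compact_convex i.
have Kopp : compact_convex [set - v | v in subF subf x u t i].
  by apply: (@imageE _ 0 (-1)) => // w; rewrite scaleN1r add0r.
case: ifP => _; [|case: ifP => _].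
- by case: Kopp.
- by case: Ksup.
rewrite (_ : [set _ | _ in _ & _ in _] =
    addset [set - v | v in subF subf x u t i] (supF supf x u t i)).
  by apply: add_compact_nonempty; [case: Kopp|case: Ksup].
apply/seteqP; split => [_ [v Sv [w Sw <-]]|_ [_ [v Sv <-] [w Sw <-]]].
  by exists (- v); [exists v|exists w].
by exists v => //; exists w.
Qed.

End SubdifferentialCompactness.

(** * The max-min formula for the functional and its reduction to pointwise problems *)

Theorem mainTheorem3 (R : realType) (n m : nat) (T : R)
    (x0 xT : 'rV[R]_n) (ulo uup : 'rV[R]_m)
    (f : 'rV[R]_n -> 'rV[R]_m -> R -> 'rV[R]_n)
    (subf supf : 'I_n -> 'rV[R]_n -> 'rV[R]_m -> R -> set 'rV[R]_(n + m))
    (x z : R -> 'rV[R]_n) (u : R -> 'rV[R]_m)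
    (hT : 0 < T)
    (hfc : {within [set p : 'rV[R]_n * 'rV[R]_m * R | p.2 \in `[0, T]],
              continuous (fun p => f p.1.1 p.1.2 p.2)})
    (hfq : forall (i : 'I_n) (y : 'rV[R]_n) (c : 'rV[R]_m) (t : R), t \in `[0, T] ->
       is_quasidifferential (fun y' c' => f y' c' t 0 i) y c
         (subf i y c t) (supf i y c t))
    (hfl : forall (i : 'I_n) (t : R), t \in `[0, T] ->
       locally_lipschitz (fun p : 'rV[R]_n * 'rV[R]_m => f p.1 p.2 t 0 i : R^o))
    (hx : {within [set t : R | t \in `[0, T]], continuous x})
    (hz : piecewise_continuous T z)
    (hu : piecewise_continuous T u)
    (hsub : upper_semicontinuous T (subphi T x0 xT ulo uup f subf supf x z u))
    (hsup : upper_semicontinuous T (supphi f subf supf x z u)) :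
  let A := subphi T x0 xT ulo uup f subf supf x z u in
  let B := supphi f subf supf x z u in
  let dI := subI T x0 xT ulo uup f subf supf x z u in
  let DI := supI T f subf supf x z u in
  let J := fun w v : R -> 'rV[R]_(n + n + m) =>
    (\int[leb R]_(t in `[0%R, T]) (sqnorm (v t + w t))%:E)%E in
  let q := fun w v : 'rV[R]_(n + n + m) => sqnorm (v + w) in
  (exists h : R -> R,
     [/\ forall t : R, t \in `[0, T] -> is_maxmin (B t) (A t) q (h t),
         (leb R).-integrable `[0, T] (EFin \o h),
         is_maxmin DI dI J (\int[leb R]_(t in `[0%R, T]) (h t)%:E)%E &
         forall t : R, t \in `[0, T] ->
           is_hausdorff_dev [set - w | w in B t] (A t) (Num.sqrt (h t))]) /\
  (forall v w : R -> 'rV[R]_(n + n + m),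
     vmeasurable T v -> vmeasurable T w ->
     (forall t : R, t \in `[0, T] -> solves_maxmin (B t) (A t) q (w t) (v t)) ->
     solves_maxmin DI dI J w v).
Proof.
move=> A B dI DI J q.
have hq t : t \in `[0, T] -> forall i, is_quasidifferential
    (fun y c => f y c t 0 i) (x t) (u t) (subf i (x t) (u t) t)
    (supf i (x t) (u t) t).
  by move=> tT i; exact: hfq.
have AP t (tT : t \in `[0, T]) : compact (A t) /\ A t !=set0.
  exact: (subphi_compact_nonempty T x0 xT ulo uup z (hq t tT)).
have BP t (tT : t \in `[0, T]) : compact (B t) /\ B t !=set0.
  exact: (supphi_compact_nonempty z (hq t tT)).
have cA t tT := (AP t tT).1; have A0 t tT := (AP t tT).2.
have cB t tT := (BP t tT).1; have B0 t tT := (BP t tT).2.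
have MA : measurable_multifunction (`[0, T] : set (lebesgueR R)) A.
  exact: usc_measurable_multifunction.
have MB : measurable_multifunction (`[0, T] : set (lebesgueR R)) B.
  exact: usc_measurable_multifunction.
have mT := measurable_segment T.
have [a bA] := usc_bounded hsub cA A0.
have [b bB] := usc_bounded hsup cB B0.
(* Uniform bounds make every measurable selection essentially bounded, so the exchange result for
   [selections] applies to [dI] and [DI]. *)
have dIE : dI = selections (`[0, T] : set (lebesgueR R)) A.
  apply/seteqP; split => v [mv vA]; split => //; first exact: in_Linfty_measurable.
  by apply: (bounded_in_Linfty mv) => t tT; exact: (bA t _ tT (vA t tT)).
have DIE : DI = selections (`[0, T] : set (lebesgueR R)) B.
  apply/seteqP; split => w [mw wB]; split => //; first exact: in_Linfty_measurable.
  by apply: (bounded_in_Linfty mw) => t tT; exact: (bB t _ tT (wB t tT)).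
have solves v w : vmeasurable T v -> vmeasurable T w ->
    (forall t, t \in `[0, T] -> solves_maxmin (B t) (A t) q (w t) (v t)) ->
    solves_maxmin DI dI J w v.
  move=> mv mw sol; rewrite dIE DIE.
  exact: (pointwise_maxmin_solves mT (leb R) MA mw mv sol).
split; last exact: solves.
have [w [v [mw mv sol]]] := measurable_maxmin_solution mT MA MB.
(* Reading the pointwise value off a measurable solution makes it measurable in [t]. *)
exists (fun t => q (w t) (v t)); split.
- by move=> t /sol[].
- apply: measurable_bounded_integrable => //.
  + rewrite -[ltLHS]/(lebesgue_measure (`[0, T] : set R)) lebesgue_measure_itv/=.
    by rewrite lte_fin hT -EFinB ltry.
  + exact: measurable_sqnorm.
  (* [a] and [b] bound the norms on [A t] and [B t], so this bounds the integrand by the triangle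
     inequality. *)
  + exists ((a + b) ^+ 2); split; first exact: num_real.
    move=> M MM t tT; have [Bw Av _ _] := sol t tT.
    rewrite /= /q -sqr_enorm ger0_norm ?sqr_ge0// (le_trans _ (ltW MM))//.
    have vw : enorm (v t + w t) <= a + b.
      rewrite (le_trans (ler_enormD _ _))// lerD//.
        exact: (bA t _ tT Av).
      exact: (bB t _ tT Bw).
    by rewrite ler_pXn2r ?nnegrE ?enorm_ge0// (le_trans (enorm_ge0 _) vw).
- by have [] := solves v w mv mw sol.
- by move=> t /sol[_ _ _]; exact: hausdorff_dev_of_maxmin.
Qed.
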